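(* Let $P$ be a loop-free pasting scheme. Then (the $\omega$-hypergraph associated with) $P$ satisfies the non-emptiness, acyclicity, relevance and segment axioms. In particular, if $P$ satisfies the torsion-freeness axiom, then $P$ is a torsion-free complex.
   Context: An $\omega$-hypergraph is a set $P$ with a partition $P=\bigsqcup_{n\in\mathbb{N}}P_n$ together with, for $n\in\mathbb{N}$ and $u\in P_{n+1}$, two finite subsets $u^-,u^+\subseteq P_n$. For $U\subseteq P$ and $\epsilon\in\{-,+\}$, $U^\epsilon=\bigcup_{u\in U}u^\epsilon$; also $U^\mp=U^-\setminus U^+$ and $U^\pm=U^+\setminus U^-$. A subset $U\subseteq P_n$ is fork-free if either $n=0$ and $|U|=1$, or $n>0$ and $u^\epsilon\cap v^\epsilon=\emptyset$ for all distinct $u,v\in U$ and all $\epsilon\in\{-,+\}$. For $U\subseteq P_n$, $\triangleleft_U$ is the transitive closure of the relation on $U$ relating $u$ to $v$ when $n\ge 1$ and $u^+\cap v^-\neq\emptyset$; for $V,W\subseteq U$, $V\triangleleft_U W$ means $v\triangleleft_U w$ for some $v\in V$, $w\in W$; a subset $V\subseteq U$ is a segment for $\triangleleft_U$ if $u_1,u_3\in V$ and $u_1\triangleleft_U u_2\triangleleft_U u_3$ imply $u_2\in V$. $u\triangleleft v$ means $u\triangleleft_{P_n}v$ for some $n\geq 1$. An $n$-pre-cell of $P$ is a tuple $X=(X_{0,-},X_{0,+},\ldots,X_{n-1,-},X_{n-1,+},X_n)$ of finite subsets $X_{i,\epsilon}\subseteq P_i$, $X_n\subseteq P_n$; one writes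 $X_{n,-}=X_{n,+}=X_n$. A finite set $M\subseteq P_{i+1}$ moves a finite $U\subseteq P_i$ to a finite $V\subseteq P_i$ if $U=(V\cup M^-)\setminus M^+$ and $V=(U\cup M^+)\setminus M^-$. An $n$-cell is an $n$-pre-cell such that $X_{i+1,\epsilon}$ moves $X_{i,-}$ to $X_{i,+}$ for $0\le i<n$, $\epsilon\in\{-,+\}$, and every $X_{i,\epsilon}$ ($0\le i\le n$) is fork-free. For $u\in P_n$, the atom $\langle u\rangle$ is the $n$-pre-cell with $\langle u\rangle_{n,-}=\langle u\rangle_{n,+}=\{u\}$ and, for $j<n$, $\langle u\rangle_{j,-}=(\langle u\rangle_{j+1,-})^\mp$, $\langle u\rangle_{j,+}=(\langle u\rangle_{j+1,+})^\pm$. A torsion-free complex is an $\omega$-hypergraph $P$ satisfying: (non-emptiness) $u^-\ne\emptyset$ and $u^+\neq\emptyset$ for all $u\in P_n$, $n\ge1$; (acyclicity) $\triangleleft$ is irreflexive; (relevance) $\langle u\rangle$ is a cell for all $u\in P$; (segment) for all $k\in\mathbb N$, $u\in P_k$, $n<k$, every $n$-cell $X$ and $\epsilon\in\{-,+\}$, if $\langle u\rangle_{n,\epsilon}\subseteq X_n$ then $\langle u\rangle_{n,\epsilon}$ is a segment for $\triangleleft_{X_n}$; (torsion-freeness) there are no $n,k,l\ge1$ with $n<\min(k,l)$, $u\in P_k$, $v\in P_l$ and $n$-cell $X$ with $\langle u\rangle_{n,+}\subseteq X_n$, $\langle v\rangle_{n,-}\subseteq X_n$, $\langle u\rangle_{n,+}\cap\langle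 v\rangle_{n,-}=\emptyset$, $\langle u\rangle_{n,+}\triangleleft_{X_n}\langle v\rangle_{n,-}$ and $\langle v\rangle_{n,-}\triangleleft_{X_n}\langle u\rangle_{n,+}$. Pasting schemes: for a relation $A$ on a graded set $P$, $A^l_k=A\cap(P_l\times P_k)$, $A(x)=\{y\mid x\,A\,y\}$, $A(X)=\bigcup_{x\in X}A(x)$, and $AA'$ is the composite relation ($x\,AA'\,z$ iff $x\,A\,y\,A'\,z$ for some $y$). A pre-pasting scheme is a graded set $P=\bigsqcup_nP_n$ with relations $B,E$ on $P$ such that: $B(x),E(x)$ are finite for all $x$; $B^l_k=E^l_k=\emptyset$ for $l<k$; $B^k_k$ and $E^k_k$ are the identity relation on $P_k$; for $A\in\{B,E\}$, $k<l$, $u\in P_{l+1}$, $v\in P_k$: $u\,A^{l+1}_k\,v$ iff $u\,A^{l+1}_lB^l_k\,v$ and $u\,A^{l+1}_lE^l_k\,v$. It is regarded as an $\omega$-hypergraph via $u^-=B^{k+1}_k(u)$, $u^+=E^{k+1}_k(u)$ for $u\in P_{k+1}$. $R$ is the smallest reflexive transitive relation on $P$ with $B(x)\cup E(x)\subseteq R(x)$ for all $x$. An $n$-fgs is a tuple $(X_0,\ldots,X_n)$ of finite $X_k\subseteq P_k$, identified with its union (with $n$ part of the data); closed means $R(X)=X$. For an $(n+1)$-fgs $X$, $\partial^-_nX=X\setminus E(X_{n+1})$ and $\partial^+_nX=X\setminus B(X_{n+1})$ (as $n$-fgs's); $\partial^\epsilon_i$ for lower $i$ is obtained by iteration. An $n$-fgs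 $X$ is well-formed if $X$ is closed, $X_n$ is fork-free and, when $n>0$, $\partial^-_{n-1}X$ and $\partial^+_{n-1}X$ are well-formed. $\mathrm{WF}(P)_n$ is the set of well-formed $n$-fgs's. For $u\in P_n$, $R(u)$ is regarded as an $n$-fgs. $P$ has a direct loop if either there are $n\geq1$ and $u,v\in P_n$ with $u\triangleleft v$ and $E(v)\cap B(u)\neq\emptyset$, or there is $w\in P$ with $E(w)\cap B(w)\neq\{w\}$. A loop-free pasting scheme is a pre-pasting scheme such that: (0) $B^{k+1}_k(u)\ne\emptyset$ and $E^{k+1}_k(u)\neq\emptyset$ for $u\in P_{k+1}$; (1) for $k\le l$, $A\in\{B,E\}$, $u\in P_{l+1}$, $v\in P_k$: if $u\,E^{l+1}_lA^l_k\,v$ then $u\,E^{l+1}_k\,v$ or $u\,B^{l+1}_lA^l_k\,v$; and if $u\,B^{l+1}_lA^l_k\,v$ then $u\,B^{l+1}_k\,v$ or $u\,E^{l+1}_lA^l_k\,v$; (2) $P$ has no direct loops; (3) $R(u)$ is well-formed for $u\in P$; (4) for $k<n$, $X\in\mathrm{WF}(P)_k$, $u\in P_n$: if $\partial^-_k(R(u))\subseteq X$ then $\langle u\rangle_{k,-}$ is a segment for $\triangleleft_{X_k}$, and if $\partial^+_k(R(u))\subseteq X$ then $\langle u\rangle_{k,+}$ is a segment for $\triangleleft_{X_k}$; (5) for $X\in\mathrm{WF}(P)_n$ and $u\in P_{n+1}$ with $\partial^-_n(R(u))\subseteq X$: $X\cap E(u)=\emptyset$, and for $y\in X$, if $B(u)\cap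 R(y)\ne\emptyset$ then $y\in B(u)$. *)

(* Defs.v *)
From mathcomp Require Import all_boot.
From mathcomp Require Import boolp classical_sets functions cardinality.
From Stdlib Require Import Relations.

Set Implicit Arguments.
Unset Strict Implicit.
Unset Printing Implicit Defensive.

Local Open Scope classical_set_scope.

Inductive sign := Minus | Plus.

Definition opp (e : sign) : sign := if e is Minus then Plus else Minus.

(* The partition of the carrier into the P_n is given by a dimension function.
   [face Minus u] is u^- and [face Plus u] is u^+; these are only meaningful in
   positive dimension, and [face_dim] forces them to be empty in dimension 0. *)
Record ohypergraph : Type := OHypergraph {
  car :> Type;
  dim : car -> nat;
  face : sign -> car -> set car;
  face_finite : forall e u, finite_set (face e u);
  face_dim : forall e u v, face e u v -> dim u = (dim v).+1
}.

Section Hypergraph.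
Variable P : ohypergraph.
Implicit Types (e : sign) (u v w : P) (U V M : set P) (n i k l : nat).

Definition cells n : set P := [set u | dim u = n].

Definition faces e U : set P := \bigcup_(u in U) face e u.

(* U^\mp for [e = Minus] and U^\pm for [e = Plus]. *)
Definition outer e U : set P := faces e U `\` faces (opp e) U.

Definition fork_free n U : Prop :=
  (n = 0 /\ exists u, U = [set u]) \/
  (0 < n /\ forall u v e, U u -> U v -> u <> v -> face e u `&` face e v = set0).

(* For U included in P_0 this relation is empty, as 0-cells have no faces. *)
Definition tri U : P -> P -> Prop :=
  clos_trans P (fun u v => [/\ U u, U v & face Plus u `&` face Minus v !=set0]).

Definition tri_set U V W : Prop := exists v w, [/\ V v, W w & tri U v w].

Definition tri_all u v : Prop := exists2 n, 0 < n & tri (cells n) u v.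

Definition segment U V : Prop :=
  V `<=` U /\
  forall u1 u2 u3, V u1 -> V u3 -> tri U u1 u2 -> tri U u2 u3 -> V u2.

Definition moves M U V : Prop :=
  U = (V `|` faces Minus M) `\` faces Plus M /\
  V = (U `|` faces Plus M) `\` faces Minus M.

(* A candidate n-pre-cell is a family X of sets with X i e = X_{i,e}; only the
   indices i <= n matter, and X_n is the common value of X n Minus and X n Plus. *)
Definition precell n (X : nat -> sign -> set P) : Prop :=
  (forall i e, i <= n -> finite_set (X i e) /\ X i e `<=` cells i) /\
  X n Minus = X n Plus.

Definition top n (X : nat -> sign -> set P) : set P := X n Minus.

Definition cell n (X : nat -> sign -> set P) : Prop :=
  [/\ precell n X,
      forall i e, i < n -> moves (X i.+1 e) (X i Minus) (X i Plus) &
      forall i e, i <= n -> fork_free i (X i e)].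

(* The pre-cell <u> of dimension [dim u]. *)
Definition atom u : nat -> sign -> set P :=
  fun j e => iter (dim u - j) (outer e) [set u].

Definition nonemptiness_axiom : Prop :=
  forall u e, 0 < dim u -> face e u !=set0.

Definition acyclicity_axiom : Prop := forall u, ~ tri_all u u.

Definition relevance_axiom : Prop := forall u, cell (dim u) (atom u).

Definition segment_axiom : Prop :=
  forall u n X e, n < dim u -> cell n X ->
    atom u n e `<=` top n X -> segment (top n X) (atom u n e).

Definition torsion_freeness_axiom : Prop :=
  ~ exists n u v X,
      [/\ 0 < n < minn (dim u) (dim v), cell n X,
          atom u n Plus `<=` top n X /\ atom v n Minus `<=` top n X,
          atom u n Plus `&` atom v n Minus = set0 &
          tri_set (top n X) (atom u n Plus) (atom v n Minus) /\
          tri_set (top n X) (atom v n Minus) (atom u n Plus)].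

Record torsion_free_complex : Prop := TorsionFreeComplex {
  tfc_nonemptiness : nonemptiness_axiom;
  tfc_acyclicity : acyclicity_axiom;
  tfc_relevance : relevance_axiom;
  tfc_segment : segment_axiom;
  tfc_torsion_freeness : torsion_freeness_axiom
}.

End Hypergraph.

(* A relation A is a set-valued map, A x = A(x) = [set y | x A y]. *)
Section Relations.
Variables (T : Type) (d : T -> nat).
Implicit Types (A : T -> set T) (X : set T).

Definition rel_gr A l k : T -> set T :=
  fun x => [set y | [/\ A x y, d x = l & d y = k]].

Definition rel_comp A A' : T -> set T :=
  fun x => [set z | exists2 y, A x y & A' y z].

Definition rel_im A X : set T := \bigcup_(x in X) A x.

End Relations.

(* The relation B is [bnd Minus], the relation E is [bnd Plus]. *)
Record prePasting : Type := PrePasting {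
  pcar :> Type;
  pdim : pcar -> nat;
  bnd : sign -> pcar -> set pcar;
  bnd_finite : forall a x, finite_set (bnd a x);
  bnd_lt : forall a l k x, l < k -> rel_gr pdim (bnd a) l k x = set0;
  bnd_diag : forall a k x y, pdim x = k -> pdim y = k ->
    (rel_gr pdim (bnd a) k k x y <-> x = y);
  bnd_step : forall a k l u v, k < l -> pdim u = l.+1 -> pdim v = k ->
    (rel_gr pdim (bnd a) l.+1 k u v <->
     rel_comp (rel_gr pdim (bnd a) l.+1 l) (rel_gr pdim (bnd Minus) l k) u v /\
     rel_comp (rel_gr pdim (bnd a) l.+1 l) (rel_gr pdim (bnd Plus) l k) u v)
}.

Section AssociatedHypergraph.
Variable P : prePasting.

Definition pface (e : sign) (u : P) : set P :=
  [set v | bnd e u v /\ pdim u = (pdim v).+1].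

Lemma pface_finite e u : finite_set (pface e u).
Proof.
by apply: (sub_finite_set _ (bnd_finite e u)) => v [].
Qed.

Lemma pface_dim e u v : pface e u v -> pdim u = (pdim v).+1.
Proof. by case. Qed.

Definition hypergraph_of : ohypergraph := OHypergraph pface_finite pface_dim.

End AssociatedHypergraph.

Canonical hypergraph_of.
Coercion hypergraph_of : prePasting >-> ohypergraph.

Section Pasting.
Variable P : prePasting.
Implicit Types (a e : sign) (u v w x y : P) (X : set P) (n i k l : nat).

Definition R (x : P) : set P :=
  [set y | clos_refl_trans P (fun u v => bnd Minus u v \/ bnd Plus u v) x y].

Definition layer X n : set P := X `&` cells n.

(* An n-fgs is identified with its union X; the dimension n is kept as a
   separate argument in all the notions below. *)
Definition fgs n X : Prop := finite_set X /\ forall x, X x -> dim x <= n.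

Definition closed X : Prop := rel_im R X = X.

(* The n-dimensional boundary of an (n+1)-fgs. *)
Definition bd1 e n X : set P := X `\` rel_im (bnd (opp e)) (layer X n.+1).

(* The i-dimensional boundary of an n-fgs, for i <= n. *)
Fixpoint bd e i n X : set P :=
  if n is m.+1 then if i <= m then bd e i m (bd1 e m X) else X else X.

(* X is a well-formed n-fgs, i.e. belongs to WF(P)_n. *)
Fixpoint wf n X : Prop :=
  [/\ fgs n X, closed X, fork_free n (layer X n) &
      if n is m.+1 then wf m (bd1 Minus m X) /\ wf m (bd1 Plus m X) else True].

Definition direct_loop : Prop :=
  (exists n u v, [/\ 0 < n, cells n u, cells n v, tri_all u v &
                     bnd Plus v `&` bnd Minus u !=set0]) \/
  (exists w, bnd Plus w `&` bnd Minus w <> [set w]).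

Local Notation gr := (rel_gr (@pdim P)).
Local Notation B := (bnd Minus).
Local Notation E := (bnd Plus).

Record loop_free : Prop := LoopFree {
  lf_nonempty : forall k u, dim u = k.+1 ->
    layer (B u) k !=set0 /\ layer (E u) k !=set0;
  lf_exchange : forall k l a u v, k <= l -> dim u = l.+1 -> dim v = k ->
    (rel_comp (gr E l.+1 l) (gr (bnd a) l k) u v ->
       gr E l.+1 k u v \/ rel_comp (gr B l.+1 l) (gr (bnd a) l k) u v) /\
    (rel_comp (gr B l.+1 l) (gr (bnd a) l k) u v ->
       gr B l.+1 k u v \/ rel_comp (gr E l.+1 l) (gr (bnd a) l k) u v);
  lf_no_direct_loop : ~ direct_loop;
  lf_wf : forall u, wf (dim u) (R u);
  lf_segment : forall k n X u, k < n -> wf k X -> dim u = n ->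
    (bd Minus k n (R u) `<=` X -> segment (layer X k) (atom u k Minus)) /\
    (bd Plus k n (R u) `<=` X -> segment (layer X k) (atom u k Plus));
  lf_relevant : forall n X u, wf n X -> dim u = n.+1 ->
    bd Minus n n.+1 (R u) `<=` X ->
    X `&` E u = set0 /\
    forall y, X y -> B u `&` R y !=set0 -> B u y
}.

End Pasting.

(* Main.v *)
Require Import Defs.
From mathcomp Require Import all_boot.
From mathcomp Require Import boolp classical_sets cardinality.
From Stdlib Require Import Relations.

(** For [u] in P_{n+1} every element of R(u) outside E(u) lies in R(u^-), and
    dually (purity, by induction on n from the exchange axiom (1) and
    acyclicity).  Hence the iterated boundaries of R(u) are the closures of the
    <u>_{j,e}; as they are well-formed, relevance reduces to the globularity of
    the <u>_{j,e}.

    For the segment axiom, a cell X is replaced by T(X), the R-closure of the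
    union of all X_{i,e}.  It suffices that T(X) is well-formed, which is shown
    by induction on the dimension: if X is an n-cell with T(X) well-formed and
    w^- is contained in X_n, axiom (5) makes the exchange of w^- for w^+ in X_n
    an n-cell again, and T loses exactly B(w) and gains exactly E(w).
    Performing these exchanges along a suitable linear extension of the
    triangle order on the top layer of an (n+1)-cell X, the absence of direct
    loops shows that T(X) minus E(X_{n+1}) is T of the source of X, and dually.
    Then axiom (4) for T(X) is the segment axiom for X. *)

Set Implicit Arguments.
Unset Strict Implicit.
Unset Printing Implicit Defensive.

Local Open Scope classical_set_scope.

(** * Minimal elements and linear extensions in finite sets *)

Lemma oppK e : opp (opp e) = e. Proof. by case: e. Qed.

Lemma seq_minimal (T : eqType) (r : T -> T -> Prop) (s : seq T) :
  (forall x, ~ r x x) -> (forall x y z, r x y -> r y z -> r x z) ->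
  s != [::] -> exists2 m, m \in s & forall m', m' \in s -> ~ r m' m.
Proof.
move=> irr tr; elim: s => // x s IH _.
have [->|/IH[m ms mmin]] := eqVneq s [::].
  by exists x; rewrite ?mem_head// => m'; rewrite inE => /eqP->.
have [rxm|nrxm] := pselect (r x m).
  exists x; rewrite ?mem_head// => m'; rewrite inE => /orP[/eqP->//|m's] rm'x.
  exact: mmin m's (tr _ _ _ rm'x rxm).
exists m; rewrite ?inE ?ms ?orbT// => m'; rewrite inE => /orP[/eqP->//|].
exact: mmin.
Qed.

Lemma finite_minimal (T : Type) (r : T -> T -> Prop) (A : set T) :
  (forall x, ~ r x x) -> (forall x y z, r x y -> r y z -> r x z) ->
  finite_set A -> A !=set0 -> exists2 m, A m & forall m', A m' -> ~ r m' m.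
Proof.
move=> irr tr fA [x Ax].
have /finite_seqP[s sA] : finite_set (A : set {classic T}) by [].
have As y : A y <-> y \in s by rewrite sA.
have s0 : s != [::] by apply/eqP => s0; move/As: Ax; rewrite s0.
have [m /As Am mmin] := @seq_minimal {classic T} r s irr tr s0.
by exists m => // m' /As; exact: mmin.
Qed.

(* Adding to [D] the elements of [D' `\` D] one at a time, along a linear
   extension of [r]. *)
Lemma finite_grow (T : Type) (r : T -> T -> Prop) (Q : set T -> Prop)
    (D D' : set T) :
  (forall x, ~ r x x) -> (forall x y z, r x y -> r y z -> r x z) ->
  finite_set D' -> D `<=` D' -> Q D ->
  (forall C w, D `<=` C -> C `<=` D' -> D' w -> ~ C w ->
     (forall w', D' w' -> r w' w -> C w') -> Q C -> Q (C `|` [set w])) ->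
  Q D'.
Proof.
move=> irr tr fD' DD' QD Qstep.
have /finite_seqP[s sD'] : finite_set (D' : set {classic T}) by [].
have Ds y : D' y -> D y \/ y \in s by rewrite sD'; right.
have {}sD' y : y \in s -> D' y by rewrite sD'.
have [m] := ubnP (size s).
elim: m s D DD' QD Qstep Ds sD' => // m IH s C CD' QC Qstep Cs sD' ssize.
have [s0|s0] := eqVneq s [::].
  suff -> : D' = C by [].
  by apply/seteqP; split => // y /Cs[]//; rewrite s0.
have [w ws wmin] := @seq_minimal {classic T} r s irr tr s0.
have CwD' : C `|` [set w] `<=` D' by move=> y [/CD'//|->]; exact: sD'.
apply: (IH [seq x <- s | x != w] (C `|` [set w])) => //.
(* The list [s] only has to cover what [C] still misses, so [w] may already lie in [C]; then nothing
   is added. *)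
- have [Cw|nCw] := pselect (C w).
    suff -> : C `|` [set w] = C by [].
    by apply/seteqP; split => [y [//|->//]|y]; left.
  apply: Qstep => //; first exact: sD'.
  by move=> w' /Cs[//|/wmin].
- by move=> B v CB; apply: Qstep => y Cy; apply: CB; left.
- move=> y /Cs[Cy|ys]; first by left; left.
  have [->|yw] := @eqVneq {classic T} y w; first by left; right.
  right; suff : (y : {classic T}) \in [seq x <- s | x != w] by [].
  by rewrite mem_filter yw.
- by move=> y; rewrite mem_filter => /andP[_ /sD'].
- rewrite size_filter; move: ssize; rewrite ltnS; apply: leq_trans.
  rewrite -(count_predC (pred1 w) s) -[X in X < _]add0n ltn_add2r.
  by rewrite -has_count has_pred1.
Qed.

Section LoopFree.
Variables (P : prePasting) (hP : loop_free P).
Implicit Types (X Y : nat -> sign -> set P) (M N S D : set P).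
Implicit Types (a b e : sign) (u v w x y c : P) (i k n : nat).

(** * Boundary relations and the triangle order *)

Lemma bnd_refl a x : bnd a x x.
Proof. by have [_ /(_ erefl) []] := bnd_diag a (erefl (pdim x)) (erefl (pdim x)). Qed.

Lemma bnd_dim a x y : bnd a x y -> dim y <= dim x.
Proof.
move=> axy; rewrite leqNgt; apply/negP => xy.
have : rel_gr (@pdim P) (bnd a) (dim x) (dim y) x y by split.
by rewrite (bnd_lt a x xy).
Qed.

Lemma bnd_same_dim a x y : bnd a x y -> dim y = dim x -> y = x.
Proof.
move=> axy xy; apply/esym.
by have [+ _] := bnd_diag a (erefl (pdim x)) xy; apply; split.
Qed.

Lemma bnd_face a x y : bnd a x y -> dim x = (dim y).+1 -> face a x y.
Proof. by []. Qed.

Lemma face_bnd a x y : face a x y -> bnd a x y. Proof. by case. Qed.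

Lemma face_dimE a x y : face a x y -> dim x = (dim y).+1. Proof. by case. Qed.

(** In codimension at least two a boundary factors through a face of its own sign, and the sign [b]
    of the second factor can be chosen freely. *)
Lemma bndP a b u v : (dim v).+1 < dim u -> bnd a u v ->
  exists2 w, face a u w & bnd b w v.
Proof.
move=> vu auv; case du : (dim u) vu => [//|l]; rewrite ltnS => vl.
have [/(_ (And3 auv du erefl))[h1 h2] _] := bnd_step a vl du erefl.
have [w [uw _ dw] [wv _ _]] : rel_comp (rel_gr (@pdim P) (bnd a) l.+1 l)
    (rel_gr (@pdim P) (bnd b) l (dim v)) u v by case: b.
by exists w => //; split => //; rewrite -/(dim u) du dw.
Qed.

Lemma bnd_intro a u v w w' : (dim v).+1 < dim u ->
  face a u w -> bnd Minus w v -> face a u w' -> bnd Plus w' v -> bnd a u v.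
Proof.
move=> vu uw wv uw' w'v; case du : (dim u) vu => [//|l]; rewrite ltnS => vl.
have dw x : face a u x -> pdim x = l.
  by move=> /face_dimE; rewrite du => -[].
have [_ []//] := bnd_step a vl du erefl.
by split; [exists w|exists w']; split => //;
  try exact: dw; try exact: face_bnd.
Qed.

Lemma exchange e b u v w : face (opp e) u w -> bnd b w v ->
  bnd (opp e) u v \/ exists2 w', face e u w' & bnd b w' v.
Proof.
move=> uw wv; have du := face_dimE uw.
have vw : dim v <= dim w by exact: bnd_dim wv.
have [h1 h2] := lf_exchange hP b vw du erefl.
have cmp a : face a u w -> rel_comp (rel_gr (@pdim P) (bnd a) (dim w).+1 (dim w))
    (rel_gr (@pdim P) (bnd b) (dim w) (dim v)) u v.
  by move=> /face_bnd auw; exists w; split.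
have res a : rel_comp (rel_gr (@pdim P) (bnd a) (dim w).+1 (dim w))
    (rel_gr (@pdim P) (bnd b) (dim w) (dim v)) u v ->
    exists2 w', face a u w' & bnd b w' v.
  case=> w' [uw' _ dw'] [w'v _ _]; exists w' => //; split => //.
  by rewrite -/(dim u) du dw'.
case: e uw => /= /cmp.
- by move=> /h1[[]|/res]; [left|right].
- by move=> /h2[[]|/res]; [left|right].
Qed.

Lemma R_refl x : R x x. Proof. exact: rt_refl. Qed.
Lemma R_trans x y z : R x y -> R y z -> R x z.
Proof. by move=> xy yz; apply: rt_trans xy yz. Qed.
Lemma bnd_R a x y : bnd a x y -> R x y.
Proof. by move=> axy; apply: rt_step; case: a axy; [left|right]. Qed.
Lemma face_R a x y : face a x y -> R x y.
Proof. by move=> /face_bnd/bnd_R. Qed.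

Lemma R_face u x : R u x -> x = u \/ exists a w, face a u w /\ R w x.
Proof.
move=> ux; have {ux} := clos_rt_rt1n _ _ _ _ ux; elim=> [|y z t yz zt IH]; first by left.
have {}yz : exists a, bnd a y z by case: yz; [exists Minus|exists Plus].
have {}zt : R z t by apply: clos_rt1n_rt.
case: yz => a yz; have := bnd_dim yz.
rewrite leq_eqVlt => /orP[/eqP zy|zy].
  by have zy' := bnd_same_dim yz zy; subst z.
right; move: (zy); rewrite leq_eqVlt => /orP[/eqP zy'|zy'].
  by exists a, z; split => //; apply: bnd_face.
have [w yw wz] := bndP a zy' yz.
by exists a, w; split => //; apply: R_trans zt; exact: bnd_R wz.
Qed.

Lemma R_dim u x : R u x -> dim x <= dim u.
Proof.
elim=> [{}u {}x [/bnd_dim|/bnd_dim]//|//|x1 y z _ h1 _ h2].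
exact: leq_trans h2 h1.
Qed.

Lemma R_same_dim u x : R u x -> dim x = dim u -> x = u.
Proof.
move=> /R_face[//|[a [w [uw /R_dim]]]] wx xu.
by move: wx; rewrite xu (face_dimE uw) ltnn.
Qed.

Lemma tri_all_cells n u v : 0 < n -> tri (@cells P n) u v -> tri_all u v.
Proof. by exists n. Qed.

Lemma tri_face n (u v c : P) : dim u = n.+1 -> dim v = n.+1 ->
  face Plus u c -> face Minus v c -> tri (@cells P n.+1) u v.
Proof. by move=> du dv uc vc; apply: t_step; split => //; exists c. Qed.

Lemma tri_trans U (u v w : P) : tri U u v -> tri U v w -> tri U u w.
Proof. by move=> uv vw; apply: t_trans uv vw. Qed.

Lemma bnd_inter a w x : bnd a w x -> bnd (opp a) w x -> x = w.
Proof.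
move=> h1 h2; have : bnd Plus w x /\ bnd Minus w x by case: a h1 h2.
move=> [wE wB]; apply: contrapT => xw; apply: (lf_no_direct_loop hP).
right; exists w => ww; apply: xw.
by have : (bnd Plus w `&` bnd Minus w) x by []; rewrite ww.
Qed.

Lemma no_tri_loop n u v x : 0 < n -> tri (@cells P n) u v ->
  bnd Minus u x -> bnd Plus v x -> False.
Proof.
move=> n0 uv ux vx; apply: (lf_no_direct_loop hP); left; exists n, u, v.
split => //; last by exists x.
- by elim: uv => [? ? []|].
- by elim: uv => [? ? []|].
- exact: tri_all_cells uv.
Qed.

Lemma tri_split U u v : tri U u v ->
  exists w, [/\ U u, U w, face Plus u `&` face Minus w !=set0 &
    w = v \/ tri U w v].
Proof.
move=> uv; case: (clos_trans_t1n _ _ _ _ uv) => [w [Uu Uw h]|w z [Uu Uw h] wz].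
  by exists w; split => //; left.
exists w; split => //; right; exact: clos_t1n_trans.
Qed.

(** A cycle at [u] starts with some [w] and some x in the intersection of u^+ and w^-. If [w]
    precedes [u], this x makes a direct loop; if w = u, then E(u) and B(u) share more than [u]. *)
Lemma acyclic : acyclicity_axiom P.
Proof.
move=> u [n n0 uu]; have [w [Uu Uw [x [xu xw]] [wu|wu]]] := tri_split uu.
  move: xw; rewrite wu => xw.
  have xe := bnd_inter (a := Plus) (face_bnd xu) (face_bnd xw).
  by have := face_dimE xu; rewrite xe => /n_Sn.
exact: no_tri_loop n0 wu (face_bnd xw) (face_bnd xu).
Qed.

Lemma tri_irr n u : ~ tri (@cells P n.+1) u u.
Proof. by move=> uu; apply: (acyclic (u := u)); exists n.+1. Qed.

Lemma nonempty : nonemptiness_axiom P.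
Proof.
move=> u e; case du : (dim u) => [//|k] _.
have [[x [ux dx]] [y [uy dy]]] := lf_nonempty hP du.
by case: e; [exists x|exists y]; split => //; rewrite -/(dim u) du ?dx ?dy.
Qed.

(* By acyclicity, take a cell of [M] with a face in [phi] that is minimal
   (maximal, for [e = Plus]) for the triangle order. *)
Lemma outer_witness n M e (phi : P -> Prop) :
  finite_set M -> M `<=` @cells P n.+1 ->
  (forall m c, M m -> face (opp e) m c -> phi c ->
     exists2 c', face e m c' & phi c') ->
  (exists a m c, [/\ M m, face a m c & phi c]) ->
  exists2 c, outer e M c & phi c.
Proof.
move=> fM Mn prop [a [m0 [c0 [Mm0 mc0 pc0]]]].
pose A := [set m | M m /\ exists2 c, face e m c & phi c].
have A0 : A !=set0.
  exists m0; split => //; have [ae|ae] : a = opp e \/ a = e.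
  - by case: (a); case: (e); [right|left|left|right].
  - by apply: prop pc0 => //; rewrite -ae.
  - by exists c0; rewrite -?ae.
have fA : finite_set A by apply: sub_finite_set fM => m [].
pose r u v := if e is Minus then tri (@cells P n.+1) u v
  else tri (@cells P n.+1) v u.
have irr x : ~ r x x by rewrite /r; case: (e); exact: tri_irr.
have tr x y z : r x y -> r y z -> r x z.
  by rewrite /r; case: (e) => h1 h2; [apply: tri_trans h1 h2|apply: tri_trans h2 h1].
have [m [Mm [c mc pc]] mmin] := finite_minimal irr tr fA A0.
exists c => //; split; first by exists m.
case=> m' Mm' m'c; apply: (mmin m').
  by split => //; exact: prop m'c pc.
rewrite /r; case: (e) mc m'c => /= mc m'c.
- exact: (tri_face (Mn _ Mm') (Mn _ Mm) m'c mc).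
- exact: (tri_face (Mn _ Mm) (Mn _ Mm') mc m'c).
Qed.

(** * Purity of the closures R(u) *)

Definition pure n : Prop := forall e u x, dim u = n ->
  R u x -> ~ bnd (opp e) u x -> exists2 w, face e u w & R w x.

(** Purity of each member of [M] trades an opposite face above [x] for an [e]-face above [x], so
    [outer_witness] yields an [e]-face above [x] that no opposite face cancels. *)
Lemma pure_set n M e x : pure n.+1 -> finite_set M -> M `<=` @cells P n.+1 ->
  rel_im (@R P) M x -> ~ rel_im (bnd (opp e)) M x -> rel_im (@R P) (outer e M) x.
Proof.
move=> pn fM Mn [m Mm mx] nx.
have nbd m' : M m' -> ~ bnd (opp e) m' x by move=> Mm' m'x; apply: nx; exists m'.
have [||c mc cx] := outer_witness fM Mn (e := e) (phi := fun c => R c x).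
- move=> m' c Mm' m'c cx; apply: pn; [exact: Mn| |exact: nbd].
  exact: R_trans (face_R m'c) cx.
- have [c mc cx] := pn e m x (Mn _ Mm) mx (nbd _ Mm).
  by exists e, m, c.
by exists c.
Qed.

Lemma purity n : pure n.
Proof.
elim/ltn_ind: n => n IH e u x du ux nux.
have [xu|[a [w [uw wx]]]] := R_face ux; first by rewrite xu in nux; case: (nux (bnd_refl _ _)).
have [ae|ae] : a = e \/ a = opp e.
  by case: (a); case: (e); [left|right|right|left].
  by exists w => //; rewrite -ae.
subst a; have dw := face_dimE uw.
have xw : dim x < dim w.
  rewrite ltn_neqAle (R_dim wx) andbT; apply/eqP => xw.
  by apply: nux; rewrite (R_same_dim wx xw); exact: face_bnd.
case dw' : (dim w) xw => [//|m] xm.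
set M := face (opp e) u.
have Mm : M `<=` @cells P m.+1.
  by move=> y /face_dimE; rewrite dw dw' => -[].
have fM : finite_set M by exact: face_finite.
have Mx : rel_im (@R P) M x by exists w.
have pm : pure m.+1 by apply: IH; rewrite -du dw dw'.
(* If [x] lay in both B(M) and E(M), [bnd_intro] would put it in the excluded boundary of [u]. So
   one of them misses [x], and purity one dimension lower applies to [M]. *)
have [a [v av vx]] : exists a, rel_im (@R P) (outer a M) x.
  have [[v uv vx]|nE] := pselect (rel_im (bnd Plus) M x); last first.
    exists Minus; exact: (pure_set (e := Minus)) pm fM Mm Mx nE.
  have [[v' uv' v'x]|nB] := pselect (rel_im (bnd Minus) M x); last first.
    exists Plus; exact: (pure_set (e := Plus)) pm fM Mm Mx nB.
  case: nux; apply: (bnd_intro _ uv' v'x uv vx).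
  by rewrite dw dw' ltnS.
case: av => -[w1 uw1 w1v] nv.
have dv : dim u = (dim v).+2 by rewrite (face_dimE uw1) (face_dimE w1v).
(* Either [v] lies below an [e]-face of [u], as wanted, or it lies in a boundary of [u] and hence,
   by free choice of sign in [bndP], is also a face of [M] of sign [opp a], contradicting
   outerness. *)
have [uv|[w' uw' w'v]] := exchange uw1 (face_bnd w1v); last first.
  by exists w' => //; apply: R_trans vx; exact: bnd_R w'v.
case: nv.
have [|w2 uw2 w2v] := bndP (opp a) _ uv; first by rewrite dv.
exists w2 => //; apply: bnd_face => //.
by have := face_dimE uw2; rewrite dv => -[].
Qed.

Lemma R_outer n M e x : finite_set M -> M `<=` @cells P n.+1 ->
  rel_im (@R P) M x -> ~ rel_im (bnd (opp e)) M x -> rel_im (@R P) (outer e M) x.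
Proof. exact: pure_set (@purity n.+1). Qed.


(** * Boundaries of atoms *)

Lemma wf_fgs n M : wf n M -> fgs n M. Proof. by case: n => [|n] []. Qed.
Lemma wf_closed n M : wf n M -> Defs.closed M. Proof. by case: n => [|n] []. Qed.
Lemma wf_fork_free n M : wf n M -> fork_free n (layer M n).
Proof. by case: n => [|n] []. Qed.
Lemma wf_bd1 e n M : wf n.+1 M -> wf n (bd1 e n M).
Proof. by case: e => -[_ _ _ []]. Qed.

Lemma closed_R M x y : Defs.closed M -> M x -> R x y -> M y.
Proof. by move=> cX Xx xy; rewrite -cX; exists x. Qed.

Lemma rel_imR_closed M : Defs.closed (rel_im (@R P) M).
Proof.
apply/seteqP; split=> x.
  by move=> [y [z Mz zy] yx]; exists z => //; exact: R_trans yx.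
by move=> Mx; exists x => //; exact: R_refl.
Qed.

Lemma sub_rel_imR M : M `<=` rel_im (@R P) M.
Proof. by move=> x Mx; exists x => //; exact: R_refl. Qed.

Lemma rel_imR1 u : rel_im (@R P) [set u] = R u.
Proof. by apply/seteqP; split => [x [y ->]//|x ux]; exists u. Qed.

Lemma layer_rel_imR n M : M `<=` @cells P n -> layer (rel_im (@R P) M) n = M.
Proof.
move=> Mn; apply/seteqP; split => [x [[m Mm mx] xn]|x Mx].
  by rewrite (R_same_dim mx) // (Mn _ Mm).
by split; [exact: sub_rel_imR|exact: Mn].
Qed.

Lemma outer_cells n e M : M `<=` @cells P n.+1 -> outer e M `<=` @cells P n.
Proof.
by move=> Mn x [[m /Mn mn /face_dimE mx] _]; move: mx; rewrite mn => -[].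
Qed.

Lemma outer_not_bnd n M e c : M `<=` @cells P n.+1 -> outer e M c ->
  ~ rel_im (bnd (opp e)) M c.
Proof.
move=> Mn Mc; have cn := outer_cells Mn Mc; case: Mc => _ nc [m Mm mc].
by apply: nc; exists m => //; apply: bnd_face => //; rewrite (Mn _ Mm) cn.
Qed.

(** The boundary of R(M) is well-formed, hence closed, and contains [outer e M]; so it contains the
    closure of that set. *)
Lemma wf_R_not_bnd n M e : M `<=` @cells P n.+1 -> wf n.+1 (rel_im (@R P) M) ->
  rel_im (@R P) (outer e M) `<=` ~` rel_im (bnd (opp e)) M.
Proof.
move=> Mn wM x [c Mc cx].
have /wf_closed/closed_R cl := wf_bd1 e wM.
have /cl/(_ cx)[_] : bd1 e n (rel_im (@R P) M) c.
  split; last by rewrite layer_rel_imR //; exact: outer_not_bnd Mn Mc.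
  by case: Mc => -[m Mm mc] _; exists m => //; exact: face_R mc.
by rewrite layer_rel_imR.
Qed.

Lemma bd1_R n M e : M `<=` @cells P n.+1 -> wf n.+1 (rel_im (@R P) M) ->
  bd1 e n (rel_im (@R P) M) = rel_im (@R P) (outer e M).
Proof.
move=> Mn wM; have fM : finite_set M.
  by have [fR _] := wf_fgs wM; apply: sub_finite_set fR; exact: sub_rel_imR.
rewrite /bd1 layer_rel_imR //; apply/seteqP; split => [x [Mx nx]|x Mx].
  exact: R_outer fM Mn Mx nx.
split; last exact: wf_R_not_bnd Mn wM _ Mx.
by case: Mx => c [[m Mm mc] _] cx; exists m => //; exact: R_trans (face_R mc) cx.
Qed.

Lemma bd_id e n M : bd e n n M = M.
Proof. by case: n => [//|n] /=; rewrite ltnn. Qed.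

Lemma bd_R n M e j : j <= n -> M `<=` @cells P n -> wf n (rel_im (@R P) M) ->
  [/\ iter (n - j) (outer e) M `<=` @cells P j,
      bd e j n (rel_im (@R P) M) = rel_im (@R P) (iter (n - j) (outer e) M) &
      wf j (rel_im (@R P) (iter (n - j) (outer e) M))].
Proof.
elim: n M => [|n IH] M; first by rewrite leqn0 => /eqP->; split.
rewrite leq_eqVlt => /orP[/eqP->|]; first by rewrite subnn bd_id; split.
rewrite ltnS => jn Mn wM; rewrite subSn // iterSr /= jn (bd1_R e Mn wM).
by apply: IH => //; [exact: outer_cells Mn|rewrite -(bd1_R e Mn wM); exact: wf_bd1].
Qed.

Lemma wf_atom e u j : j <= dim u ->
  [/\ atom u j e `<=` @cells P j,
      bd e j (dim u) (R u) = rel_im (@R P) (atom u j e) &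
      wf j (rel_im (@R P) (atom u j e))].
Proof.
move=> ju; have := @bd_R (dim u) [set u] e j ju.
by rewrite rel_imR1; apply; [move=> ? ->|exact: lf_wf].
Qed.

Lemma faceR_not_bnd e u w x : face e u w -> R w x -> ~ bnd (opp e) u x.
Proof.
move=> uw wx ux; have du := face_dimE uw.
have un : [set u] `<=` @cells P (dim w).+1 by move=> ? ->.
have wu : wf (dim w).+1 (rel_im (@R P) [set u]).
  by rewrite rel_imR1 -du; exact: lf_wf.
apply: (wf_R_not_bnd (e := e) un wu (t := x)); last by exists u.
exists w => //; split; first by exists u.
move=> [v -> uw']; have wu' := bnd_inter (face_bnd uw) (face_bnd uw').
by move: du; rewrite wu' => /n_Sn.
Qed.

(** * Globularity of atoms and relevance *)

Lemma outer_outer n N e d : N `<=` @cells P n.+2 -> wf n.+2 (rel_im (@R P) N) ->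
  outer e (outer d N) `<=` outer e (outer (opp d) N).
Proof.
move=> Nn wN; have fN : finite_set N.
  by have [fR _] := wf_fgs wN; apply: sub_finite_set fR; exact: sub_rel_imR.
(* By the exchange axiom a [b]-face [x] of some face of [N] can be moved to a [b]-face of
   [outer d' N], unless [x] lies in the boundary of [N] of sign [opp d']. *)
have back d' b x a m c : ~ rel_im (bnd (opp d')) N x ->
    N m -> face a m c -> face b c x -> faces b (outer d' N) x.
  move=> nx Nm mc cx.
  have [||c' mc' cx'] := outer_witness fN Nn (e := d') (phi := fun c => face b c x).
  - move=> m' c1 Nm' m'c1 /[dup] c1x /face_bnd c1x'.
    have [m'x|[c2 m'c2 c2x]] := exchange m'c1 c1x'; first by case: nx; exists m'.
    exists c2 => //; apply: bnd_face => //.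
    by move: (face_dimE m'c1); rewrite (face_dimE m'c2) -(face_dimE c1x) => -[].
  - by exists a, m, c.
  - by exists c'.
move=> x [[c dNc cx] nx].
have [[m Nm mc] _] := dNc.
have xd : ~ rel_im (bnd (opp d)) N x.
  by apply: (wf_R_not_bnd Nn wN); exists c => //; exact: face_R cx.
have dx : (dim x).+2 = n.+2 by rewrite -(Nn _ Nm) (face_dimE mc) (face_dimE cx).
(* Otherwise [bndP] shows [x] as a face of sign [opp e] of some face of [N], and [back] moves it to
   [outer d N], where [nx] forbids it. *)
have xd' : ~ rel_im (bnd d) N x.
  move=> [m' Nm' m'x]; have [|w m'w wx] := bndP (opp e) _ m'x.
    by rewrite (Nn _ Nm') dx.
  apply: nx; apply: (back _ _ _ _ _ _ xd Nm' m'w); apply: bnd_face => //.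
  by have := face_dimE m'w; rewrite (Nn _ Nm') -dx => -[].
split; first by apply: (back _ _ _ _ _ _ _ Nm mc cx); rewrite oppK.
by move=> [c' [[m' Nm' m'c'] _] c'x]; apply: nx; exact: back xd Nm' m'c' c'x.
Qed.

Lemma atom_outer u j e : j < dim u -> atom u j e = outer e (atom u j.+1 e).
Proof. by move=> ju; rewrite /atom -subnSK. Qed.

Lemma atom_top u e : atom u (dim u) e = [set u].
Proof. by rewrite /atom subnn. Qed.

(** Induction on the codimension: globularity one dimension up presents the two layers as [outer d]
    and [outer e] of a common set, to which [outer_outer] applies in both directions. *)
Lemma atom_globular u j e d : j < dim u ->
  outer e (atom u j.+1 d) = outer e (atom u j.+1 e).
Proof.
elim/ltn_ind: {j}(dim u - j) {-2}j (erefl (dim u - j)) e d => k IH j ejk e d ju.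
have [->|de] : d = e \/ d = opp e by case: (d); case: (e); auto.
  by [].
move: (ju); rewrite leq_eqVlt => /orP[/eqP ->|ju1]; first by rewrite !atom_top.
have [an _ wa] := wf_atom e ju1.
have [an' _ wa'] := wf_atom d ju1.
have kk : dim u - j.+1 < k by rewrite -ejk ltn_sub2l.
have H := IH _ kk _ erefl _ _ ju1.
rewrite !(atom_outer _ ju1).
apply/seteqP; split.
- have := outer_outer (e := e) (d := d) an' wa'.
  by rewrite (_ : opp d = e) ?de ?oppK // -de (H e d).
- have := outer_outer (e := e) (d := e) an wa.
  by rewrite -de (H d e).
Qed.

Lemma moves_outer M : moves M (outer Minus M) (outer Plus M).
Proof.
split; apply/seteqP; split => x.
- by move=> [? ?]; split => //; right.
- by move=> [[[]//|] ].
- by move=> [? ?]; split => //; right.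
- by move=> [[[]//|] ].
Qed.

Lemma relevance : relevance_axiom P.
Proof.
move=> u; split.
- split; last by rewrite !atom_top.
  move=> i e iu; have [an _ wa] := wf_atom e iu; split => //.
  by have [fR _] := wf_fgs wa; apply: sub_finite_set fR; exact: sub_rel_imR.
- move=> i e iu; rewrite !(atom_outer _ iu).
  by rewrite -(atom_globular Minus e) // -(atom_globular Plus e) //; exact: moves_outer.
- move=> i e iu; have [an _ wa] := wf_atom e iu.
  by rewrite -[X in fork_free i X](layer_rel_imR an); exact: wf_fork_free.
Qed.

(** * Hulls and truncations of cells *)

(* [hull n X] is the T(X) above, for an n-cell [X]. *)
Definition hull n (X : nat -> sign -> set P) : set P :=
  rel_im (@R P) [set y | exists i e, i <= n /\ X i e y].

(** This serves both to pass from an (n+1)-cell to one of its boundaries and to change the top layer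
    of an n-cell; layers above [n] are left as they are, since [cell n] and [hull n] do not see
    them. *)
Definition cut n (S : set P) (X : nat -> sign -> set P) i e : set P :=
  if i == n then S else X i e.

Lemma hullI n X i e y x : i <= n -> X i e y -> R y x -> hull n X x.
Proof. by move=> ni Xy yx; exists y => //; exists i, e. Qed.

Lemma topE n X e : cell n X -> X n e = top n X.
Proof. by move=> [[_ XnE] _ _]; case: e; rewrite /top ?XnE. Qed.

Lemma cell_dim n X i e y : cell n X -> i <= n -> X i e y -> dim y = i.
Proof. by move=> [[/(_ i e) h _] _ _] /h[_]; apply. Qed.

Lemma cut_top n S X : top n (cut n S X) = S.
Proof. by rewrite /top /cut eqxx. Qed.

Lemma cut_eq n S X e : cut n S X n e = S. Proof. by rewrite /cut eqxx. Qed.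

Lemma cut_lt n S X i e : i < n -> cut n S X i e = X i e.
Proof. by rewrite /cut; case: ltngtP. Qed.

Lemma cut_cut n S S' X : cut n S (cut n S' X) = cut n S X.
Proof. by apply/funext => i; apply/funext => e; rewrite /cut; case: eqP. Qed.

Lemma cell_cut n X S : cell n.+1 X \/ cell n X ->
  finite_set S -> S `<=` @cells P n -> fork_free n S ->
  (forall m, n = m.+1 -> moves S (X m Minus) (X m Plus)) -> cell n (cut n S X).
Proof.
move=> cX fS Sn ffS mS.
have [fin [mov ff]] : (forall i e, i < n -> finite_set (X i e) /\ X i e `<=` @cells P i) /\
  (forall i e, i.+1 < n -> moves (X i.+1 e) (X i Minus) (X i Plus)) /\
  (forall i e, i < n -> fork_free i (X i e)).
  case: cX => -[[fin _] mov ff]; split=> [i e lin|].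
  - exact/fin/leqW/ltnW.
  - split=> i e lin; first exact/mov/leqW/ltnW.
    exact/ff/leqW/ltnW.
  - exact/fin/ltnW.
  - by split=> i e lin; [exact/mov/ltnW|exact/ff/ltnW].
split.
- split; last by rewrite !cut_eq.
  move=> i e; rewrite leq_eqVlt => /orP[/eqP ->|lin]; first by rewrite cut_eq.
  by rewrite cut_lt //; exact: fin.
- move=> i e lin; rewrite !(cut_lt _ _ _ lin).
  move: (lin); rewrite leq_eqVlt => /orP[/eqP iE|lin'].
    by rewrite [cut n S X i.+1 e](_ : _ = S); [exact: mS|rewrite /cut iE eqxx].
  by rewrite (cut_lt _ _ _ lin'); exact: mov.
- move=> i e; rewrite leq_eqVlt => /orP[/eqP ->|lin]; first by rewrite cut_eq.
  by rewrite cut_lt //; exact: ff.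
Qed.

Lemma cell_bd n X e : cell n.+1 X -> cell n (cut n (X n e) X).
Proof.
move=> cX; have [[fin _] mov ff] := cX; have [fX Xn] := fin n e (leqnSn n).
apply: cell_cut => //; [by left|exact: ff|].
by move=> m nE; move: (mov m e); rewrite -nE; apply; rewrite nE.
Qed.

Lemma movesP (M U V : set P) : moves M U V <-> forall x,
  (U x <-> (V x \/ faces Minus M x) /\ ~ faces Plus M x) /\
  (V x <-> (U x \/ faces Plus M x) /\ ~ faces Minus M x).
Proof.
split=> [[-> VE] x|h].
- by split=> //; rewrite {1}VE.
- by split; apply/seteqP; split => x; have [h1 h2] := h x; by [move/h1|move/h2].
Qed.

Lemma facesU e (M N : set P) x : faces e (M `|` N) x <-> faces e M x \/ faces e N x.
Proof. by rewrite /faces bigcup_setU. Qed.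

Lemma fork_free_faces n (S A : set P) e x : 0 < n -> fork_free n S -> A `<=` S ->
  faces e A x -> faces e (S `\` A) x -> False.
Proof.
move=> n0 [[n0']|[_ ff]]; first by move: n0; rewrite n0'.
move=> AS [c Ac cx] [c' [Sc' nAc'] c'x].
have cc' : c <> c' by move=> cc'; apply: nAc'; rewrite -cc'.
have := ff c c' e (AS _ Ac) Sc' cc'.
by move=> /seteqP[/(_ x)] => /(_ (conj cx c'x)).
Qed.

(** * Exchanging the source of a generator for its target *)

Section Activation.
Variables (n : nat) (X : nat -> sign -> set P) (w : P).
Hypotheses (cX : cell n X) (wX : wf n (hull n X)).
(** By [bndP], a lower element of B(w) lies in both B(w^-) and E(w^-); as w^- is in the top layer,
    this hypothesis keeps the lower layers away from B(w). *)
Hypothesis lowX : forall i e y, i < n -> X i e y ->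
  exists a, ~ rel_im (bnd a) (top n X) y.
Hypotheses (dw : dim w = n.+1) (wS : face Minus w `<=` top n X).

Let S := top n X.
Let S' := (S `\` face Minus w) `|` face Plus w.
Let Y := cut n S' X.

(** Purity puts this source into the closure of w^-; it is the premise of [lf_relevant], whose two
    conclusions follow. *)
Lemma source_sub : bd Minus n n.+1 (R w) `<=` hull n X.
Proof.
move=> x /=; rewrite leqnn bd_id => -[wx nx].
have [|c wc cx] := purity dw wx (e := Minus).
  by move=> wx'; apply: nx; exists w => //; split => //; exact: R_refl.
by apply: (hullI (i := n) (e := Minus)) cx => //; exact: wS.
Qed.

Lemma hull_target x : hull n X x -> ~ bnd Plus w x.
Proof.
move=> Xx wx; have [XE _] := lf_relevant hP wX dw source_sub.
by have : (hull n X `&` bnd Plus w) x by []; rewrite XE.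
Qed.

Lemma hull_source y x : hull n X y -> R y x -> bnd Minus w x -> bnd Minus w y.
Proof.
move=> Xy yx wx; have [_] := lf_relevant hP wX dw source_sub.
by apply=> //; exists x.
Qed.

Lemma act_fork_free : fork_free n S'.
Proof.
have [_ _ /(_ n Minus (leqnn n)) ffS] := cX.
have ffw : fork_free n (face Plus w).
  have w1 : [set w] `<=` @cells P n.+1 by move=> ? ->.
  have wR : wf n.+1 (rel_im (@R P) [set w]) by rewrite rel_imR1 -dw; exact: lf_wf.
  have := wf_fork_free (wf_bd1 Plus wR); rewrite (bd1_R Plus w1 wR) layer_rel_imR; last first.
    exact: outer_cells.
  congr fork_free; apply/seteqP; split=> [x [[_ -> //]]|x wx].
  split; first by exists w.
  move=> [_ -> wx']; exact: (faceR_not_bnd wx (R_refl x)) (face_bnd wx').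
(* In dimension 0 the top layer is a singleton, which the nonempty set w^- exhausts. *)
have [n0|n0] := posnP n.
  case: ffS => [[_ [a SE]]|[]]; last by rewrite n0.
  have [|y wy] := nonempty (u := w) Minus; first by rewrite dw.
  rewrite /S' (_ : _ `\` _ = set0) ?set0U //.
  apply/seteqP; split=> // c [Sc nc]; apply: nc.
  have : S y by exact: wS.
  by move: Sc; rewrite /S /top SE /= => -> <-.
(* Exchange turns a common face with w^+ either into an element of E(w) in the hull, or into a
   common face with w^-, against fork-freeness of [S]. *)
have mixed e (a b : P) : (S `\` face Minus w) a -> face Plus w b ->
    face e a `&` face e b = set0.
  move=> [Sa nwa] wb; apply/seteqP; split=> // z [az bz].
  have [wz|[c wc cz]] := exchange (e := Minus) wb (face_bnd bz).
    apply: (hull_target _ wz); apply: (hullI (i := n) (e := Minus)) (face_R az) => //.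
  have {}cz : face e c z.
    apply: bnd_face => //; move: (face_dimE wb).
    by rewrite (face_dimE wc) (face_dimE bz) => -[].
  apply: (@fork_free_faces n S (face Minus w) e z) => //.
  - by exists c.
  - by exists a.
right; split => // a b e [Sa|wa] [Sb|wb] ab.
- case: ffS => [[n0']|[_]]; first by move: n0; rewrite n0'.
  by apply=> //; [case: Sa|case: Sb].
- exact: mixed.
- by rewrite setIC; exact: mixed.
- case: ffw => [[n0']|[_]]; first by move: n0; rewrite n0'.
  exact.
Qed.

(** The condition is checked at each [x], according to whether [x] lies in E(w), in B(w), or in
    neither. *)
Lemma act_moves m : n = m.+1 -> moves S' (X m Minus) (X m Plus).
Proof.
move=> nE; have [[_ _] /(_ m Minus) + /(_ n Minus (leqnn n)) ffS] := cX.
rewrite -nE leqnn => /(_ isT) /movesP mS; apply/movesP => x.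
have {mS} := mS x; rewrite -/(top n X) -/S.
have n0 : 0 < n by rewrite nE.
have splitS e : faces e S x <-> faces e (face Minus w) x \/ faces e (S `\` face Minus w) x.
  rewrite -facesU; suff -> : face Minus w `|` (S `\` face Minus w) = S by [].
  exact: setDUK.
have disj e : faces e (face Minus w) x -> faces e (S `\` face Minus w) x -> False.
  exact: (fork_free_faces n0 ffS wS).
have splitS' e : faces e S' x <-> faces e (S `\` face Minus w) x \/ faces e (face Plus w) x.
  exact: facesU.
have XR e : X m e x -> ~ bnd Plus w x.
  by move=> Xx; apply: hull_target; apply: (hullI _ Xx (R_refl x)); rewrite nE.
have SR e c : S c -> face e c x -> ~ bnd Plus w x.
  move=> Sc cx; apply: hull_target.
  exact: (hullI (e := Minus) (leqnn n) Sc (face_R cx)).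
have minusR e : faces e (face Minus w) x -> ~ bnd Plus w x.
  by move=> [c wc cx]; exact: (SR _ _ (wS wc) cx).
have restR e : faces e (S `\` face Minus w) x -> ~ bnd Plus w x.
  by move=> [c [Sc _] cx]; exact: (SR _ _ Sc cx).
have plusR e : faces e (face Plus w) x -> ~ bnd Minus w x.
  by move=> [c wc cx]; exact: (faceR_not_bnd wc (face_R cx)).
have both e a b : bnd a w x -> faces e (face a w) x -> faces b (face a w) x.
  move=> wx [c wc cx]; have dwx : dim w = (dim x).+2.
    by rewrite (face_dimE wc) (face_dimE cx).
  have [|c' wc' c'x] := bndP b _ wx; first by rewrite dwx.
  exists c' => //; apply: bnd_face => //.
  by have := face_dimE wc'; rewrite dwx => -[].
have exch e a : faces e (face (opp a) w) x -> bnd (opp a) w x \/ faces e (face a w) x.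
  move=> [c wc cx]; have [|[c' wc' c'x]] := exchange wc (face_bnd cx); [by left|right].
  exists c' => //; apply: bnd_face => //.
  by have := face_dimE wc; rewrite (face_dimE wc') (face_dimE cx) => -[].
(* On E(w) only w^+ contributes faces, in both signs or in none, and [x] is in neither boundary of
   [X]. *)
have [wE|nwE] := pselect (bnd Plus w x).
  have nX e : ~ X m e x by move=> /XR.
  have S'q e : faces e S' x <-> faces e (face Plus w) x.
    by rewrite splitS'; split=> [[/restR//|//]|]; right.
  rewrite !S'q => _.
  by split; split=> [/nX//|[[/nX//|h] []]]; exact: both wE h.
(* On B(w) the set w^- contributes in both signs or in none; if in both, then [x] is in neither
   boundary and fork-freeness excludes other faces at [x]. *)
have [wB|nwB] := pselect (bnd Minus w x).
  have S'q e : faces e S' x <-> faces e (S `\` face Minus w) x.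
    by rewrite splitS'; split=> [[//|/plusR//]|]; left.
  rewrite !S'q !splitS; have [p|np] := pselect (faces Minus (face Minus w) x).
    have p' : faces Plus (face Minus w) x by exact: both wB p.
    have := (disj _ p, disj _ p'); tauto.
  have np' : ~ faces Plus (face Minus w) x by move=> /(both _ Minus _ wB).
  tauto.
(* Elsewhere w^- and w^+ have the same faces at [x], by exchange. *)
have S'q e : faces e S' x <-> faces e S x.
  rewrite splitS splitS'; split=> -[h|h]; [by right| |  |by left].
  - by have [//|] := exch e Minus h; left.
  - by have [//|] := exch e Plus h; right.
by rewrite !S'q.
Qed.

Lemma act_cell : cell n Y.
Proof.
have [[/(_ n Minus (leqnn n)) [fS Sn] _] _ _] := cX.
apply: cell_cut; [by right| | |exact: act_fork_free|exact: act_moves].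
- rewrite finite_setU; split; last exact: face_finite.
  by apply: sub_finite_set fS => y [].
- move=> y [[/Sn//]|/face_dimE]; rewrite dw => -[] //.
Qed.

(** A generator of the new hull with [x] below it would itself lie in B(w) or in w^+. The former is
    excluded by removal of w^- and by [lowX], the latter by [faceR_not_bnd]. *)
Lemma act_hull_source x : hull n Y x -> ~ bnd Minus w x.
Proof.
move=> [y [i [e [ni Yy]]] yx] wx; move: ni Yy; rewrite leq_eqVlt => /orP[/eqP ->|ni].
  rewrite /Y cut_eq => -[[Sy nwy]|wy]; last exact: (faceR_not_bnd wy yx).
  have wy : bnd Minus w y.
    apply: hull_source yx wx; apply: (hullI (e := Minus) (leqnn n) _ (R_refl y)).
    exact: Sy.
  apply: nwy; apply: bnd_face => //.
  by rewrite dw (cell_dim cX (leqnn n) (e := Minus) Sy).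
rewrite /Y cut_lt // => Xy.
have wy : bnd Minus w y.
  by apply: hull_source yx wx; exact: hullI (ltnW ni) Xy (R_refl y).
have [a] := lowX ni Xy; apply.
have [|c wc cy] := bndP a _ wy; first by rewrite dw (cell_dim cX (ltnW ni) Xy).
by exists c => //; exact: wS.
Qed.

Lemma act_hull_sub : hull n X `<=` hull n Y `|` bnd Minus w.
Proof.
move=> x [y [i [e [ni Xy]]] yx]; have [wx|nwx] := pselect (bnd Minus w x).
  by right.
left; move: ni Xy; rewrite leq_eqVlt => /orP[/eqP ->|ni Xy]; last first.
  by apply: (hullI (e := e) (ltnW ni) _ yx); rewrite /Y cut_lt.
rewrite (topE _ cX) => Sy.
have [wy|nwy] := pselect (face Minus w y); last first.
  by apply: (hullI (e := e) (leqnn n) _ yx); rewrite /Y cut_eq; left.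
have [|c wc cx] := purity dw (R_trans (face_R wy) yx) (e := Plus); first exact: nwx.
by apply: (hullI (e := e) (leqnn n) _ cx); rewrite /Y cut_eq; right.
Qed.

Lemma act_hull_sup : hull n Y `<=` hull n X `|` bnd Plus w.
Proof.
move=> x [y [i [e [ni Yy]]] yx]; have [wx|nwx] := pselect (bnd Plus w x).
  by right.
left; move: ni Yy; rewrite leq_eqVlt => /orP[/eqP ->|ni]; last first.
  by rewrite /Y cut_lt // => Xy; exact: hullI (ltnW ni) Xy yx.
rewrite /Y cut_eq => -[[Sy _]|wy]; first exact: (hullI (e := Minus) (leqnn n) Sy yx).
have [|c wc cx] := purity dw (R_trans (face_R wy) yx) (e := Minus); first exact: nwx.
exact: (hullI (e := Minus) (leqnn n) (wS wc) cx).
Qed.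

End Activation.

(** * Hulls of cells are well-formed *)

(* The second half is kept in the induction because it is the hypothesis
   [lowX] of the exchange step. *)
Definition hulls_wf n : Prop := forall X, cell n X ->
  wf n (hull n X) /\
  (forall i e y, i < n -> X i e y -> exists a, ~ rel_im (bnd a) (top n X) y).

(** * Slicing an (n+1)-cell along the triangle order *)

Section Slices.
Variables (n : nat) (X : nat -> sign -> set P).
Hypotheses (gn : hulls_wf n) (cX : cell n.+1 X).

Let M := top n.+1 X.
Let lt := @tri P (@cells P n.+1).

(** For an initial [D] this is the n-cell reached from the source of [X] after the generators in [D]
    have been exchanged. *)
Definition slice D := cut n ((X n Minus `|` faces Plus D) `\` faces Minus D) X.

Definition initial D : Prop := D `<=` M /\
  forall w w', D w -> M w' -> lt w' w -> D w'.

Lemma M_dim w : M w -> dim w = n.+1.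
Proof. exact: cell_dim cX (leqnn _). Qed.

Lemma M_moves : moves M (X n Minus) (X n Plus).
Proof. by have [_ + _] := cX; apply; exact: ltnSn. Qed.

Lemma M_face_disj e w w' c : M w -> M w' -> face e w c -> face e w' c -> w = w'.
Proof.
move=> Mw Mw' wc w'c; apply: contrapT => ww'.
have [_ _ /(_ n.+1 Minus (leqnn _))[[]//|[_ ff]]] := cX.
have := ff w w' e Mw Mw' ww'.
by move=> /seteqP[/(_ c)] => /(_ (conj wc w'c)).
Qed.

Lemma slice0 : slice set0 = cut n (X n Minus) X.
Proof. by rewrite /slice /faces !bigcup_set0 setU0 setD0. Qed.

Lemma sliceM : slice M = cut n (X n Plus) X.
Proof. by rewrite /slice; have [_ <-] := M_moves. Qed.

Lemma slice_source D w : D `<=` M -> M w -> ~ D w ->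
  (forall w', M w' -> lt w' w -> D w') -> face Minus w `<=` top n (slice D).
Proof.
move=> DM Mw nDw pred c wc; rewrite cut_top; split; last first.
  by move=> [w' Dw' w'c]; apply: nDw; rewrite (M_face_disj Mw (DM _ Dw') wc w'c).
(* A face of [w] is produced by a predecessor, already in [D], or is present in the source of
   [X]. *)
have [[w' Mw' w'c]|nc] := pselect (faces Plus M c).
  right; exists w' => //; apply: pred => //.
  exact: tri_face (M_dim Mw') (M_dim Mw) w'c wc.
left; have [-> _] := M_moves; split => //.
by right; exists w.
Qed.

Lemma slice_step D w : initial D -> M w -> ~ D w ->
  slice (D `|` [set w]) =
  cut n ((top n (slice D) `\` face Minus w) `|` face Plus w) (slice D).
Proof.
move=> [DM iD] Mw nDw; rewrite cut_cut cut_top /slice; congr cut.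
have f1 e c : faces e (D `|` [set w]) c <-> faces e D c \/ face e w c.
  rewrite facesU; split=> -[h|h]; [by left| |by left|].
  - by case: h => _ -> ?; right.
  - by right; exists w.
apply/seteqP; split=> c.
  move=> [h nc]; have [wc|nwc] := pselect (face Plus w c); first by right.
  left; split; last by move=> wc; apply: nc; apply/f1; right.
  split; last by move=> Dc; apply: nc; apply/f1; left.
  by case: h => [h|/f1[h|//]]; [left|right].
move=> [[[h nc] nwc]|wc].
  split; last by move=> /f1[].
  by case: h => h; [left|right; apply/f1; left].
split; first by right; apply/f1; right.
(* If [D] consumed a target face of [w], then [w] would precede a member of the initial set [D]. *)
move=> /f1[[w' Dw' w'c]|wc'].
  apply: nDw; apply: (iD _ _ Dw' Mw).
  exact: tri_face (M_dim Mw) (M_dim (DM _ Dw')) wc w'c.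
have cw := bnd_inter (a := Plus) (face_bnd wc) (face_bnd wc').
by have := face_dimE wc; rewrite cw => /n_Sn.
Qed.

(** Generators are exchanged one by one from [D] to [D']; each step is an activation and changes the
    hull only within B(w) and E(w). *)
Lemma slices D D' : initial D -> initial D' -> D `<=` D' -> cell n (slice D) ->
  [/\ cell n (slice D'),
      hull n (slice D) `<=` hull n (slice D') `|` rel_im (bnd Minus) (D' `\` D) &
      hull n (slice D') `<=` hull n (slice D) `|` rel_im (bnd Plus) (D' `\` D)].
Proof.
move=> iD iD' DD' cD.
pose Q C := initial C /\ [/\ cell n (slice C),
      hull n (slice D) `<=` hull n (slice C) `|` rel_im (bnd Minus) (D' `\` D) &
      hull n (slice C) `<=` hull n (slice D) `|` rel_im (bnd Plus) (D' `\` D)].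
suff [] : Q D' by [].
apply: (@finite_grow _ lt Q D D') => //.
- by move=> x; exact: tri_irr.
- exact: tri_trans.
- have [[/(_ n.+1 Minus (leqnn _))[fM _] _] _ _] := cX.
  by apply: sub_finite_set fM; case: iD'.
move=> C w DC CD' D'w nCw pred [iC [cC sub sup]].
have Mw : M w by case: iD' => h _; exact: h.
have pred' w' : M w' -> lt w' w -> C w'.
  by move=> Mw' w'w; apply: pred => //; case: iD' => _; apply; eassumption.
have CM : C `<=` M by case: iC.
have wS := slice_source CM Mw nCw pred'.
have dw := M_dim Mw; have [wC lowC] := gn cC.
have D'Dw : (D' `\` D) w by split => // /DC.
split.
  split=> [y [/CM//|->//]|y w' [Cy|->] Mw' w'y]; left; last exact: pred' w'y.
  by case: iC => _; apply; eassumption.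
rewrite (slice_step iC Mw nCw); split.
- exact: act_cell.
- move=> x /sub[|]; last by right.
  move=> /(act_hull_sub cC dw)[|wx]; first by left.
  by right; exists w.
- move=> x /(act_hull_sup dw wS)[/sup//|wx].
  by right; exists w.
Qed.

Lemma initial0 : initial set0. Proof. by split. Qed.
Lemma initialM : initial M. Proof. by split. Qed.

Lemma hull_bd_target x : hull n (cut n (X n Minus) X) x -> ~ rel_im (bnd Plus) M x.
Proof.
rewrite -slice0 => Xx [w Mw wx].
(* After the predecessors of [w] are exchanged, axiom (5) applies to [w], so
   [x] must have been removed earlier, by some predecessor of [w]. *)
pose D := [set w' | M w' /\ lt w' w].
have iD : initial D.
  by split=> [y []//|y w' [My yw] Mw' w'y]; split=> //; exact: tri_trans w'y yw.
have [|cD sub _] := slices initial0 iD (@sub0set _ _).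
  by rewrite slice0; exact: cell_bd.
have nDw : ~ D w by move=> [_]; exact: tri_irr.
have wS : face Minus w `<=` top n (slice D).
  by apply: slice_source => // y [].
case: (sub _ Xx) => [Dx|[w' [[Mw' w'w] _] w'x]].
  by have [wD _] := gn cD; exact: (hull_target wD (M_dim Mw) wS Dx).
exact: (no_tri_loop (ltn0Sn n) w'w w'x wx).
Qed.

Lemma hull_bd_source x : hull n (cut n (X n Plus) X) x -> ~ rel_im (bnd Minus) M x.
Proof.
rewrite -sliceM => Xx [w Mw wx].
(* [w] is exchanged before its successors only; they alone can restore [x],
   and that would be a direct loop. *)
pose D := [set w' | [/\ M w', w' <> w & ~ lt w w']].
have iD : initial D.
  split=> [y []//|y w' [My yw nwy] Mw' w'y]; split=> // [w'w|ww'].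
    by apply: nwy; rewrite -w'w.
  by apply: nwy; exact: tri_trans ww' w'y.
have [|cD _ _] := slices initial0 iD (@sub0set _ _).
  by rewrite slice0; exact: cell_bd.
have nDw : ~ D w by move=> [].
have pred w' : M w' -> lt w' w -> D w'.
  move=> Mw' w'w; split=> // [w'E|ww'].
    by apply: (tri_irr (n := n) (u := w)); rewrite -{1}w'E.
  by apply: (tri_irr (n := n) (u := w)); exact: tri_trans ww' w'w.
have wS : face Minus w `<=` top n (slice D).
  by apply: slice_source => // y [].
have [wD lowD] := gn cD; have dw := M_dim Mw.
have cD1 : cell n (slice (D `|` [set w])).
  by rewrite slice_step //; exact: act_cell.
have iD1 : initial (D `|` [set w]).
  split=> [y [[]//|->//]|y w' [Dy|->] Mw' w'y]; left; last exact: pred w'y.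
  by case: iD => _; apply; eassumption.
have [_ _ sup] := slices iD1 initialM iD1.1 cD1.
case: (sup _ Xx) => [|[w' [Mw' nD] w'x]].
  by rewrite slice_step // => /(act_hull_source cD wD lowD dw wS).
suff ww' : lt w w' by exact: (no_tri_loop (ltn0Sn n) ww' wx w'x).
apply: contrapT => nww'; apply: nD.
have [->|w'w] := pselect (w' = w); first by right.
by left.
Qed.

Lemma hull_bd e x : hull n (cut n (X n e) X) x -> ~ rel_im (bnd (opp e)) M x.
Proof. by case: e; [exact: hull_bd_target|exact: hull_bd_source]. Qed.

End Slices.

Lemma hull_layer n X : cell n X -> layer (hull n X) n = top n X.
Proof.
move=> cX; apply/seteqP; split=> [x [[y [i [e [ni Xy]]] yx] xn]|x Xx].
  have yi := cell_dim cX ni Xy; have := R_dim yx.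
  rewrite xn yi => ni'; have {ni ni'}iE : i = n by apply/eqP; rewrite eqn_leq ni ni'.
  by rewrite (R_same_dim yx) ?xn ?yi // -(topE e cX) -iE.
split; first exact: (hullI (e := Minus) (leqnn n) Xx (R_refl x)).
exact: cell_dim cX (leqnn n) Xx.
Qed.

Lemma hull_fgs n X : cell n X -> fgs n (hull n X).
Proof.
move=> cX; split.
  apply: bigcup_finite => [|u _]; last by have [] := wf_fgs (lf_wf hP u).
  rewrite (_ : [set y | _] = \bigcup_(i in [set i | i < n.+1]) (X i Minus `|` X i Plus)).
    apply: bigcup_finite; first exact: finite_II.
    move=> i /= ni; have [[fin _] _ _] := cX; rewrite finite_setU.
    by split; [have [] := fin i Minus ni|have [] := fin i Plus ni].
  apply/seteqP; split=> y.
    by move=> [i [e [ni Xy]]]; exists i => //; case: e Xy; [left|right].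
  by move=> [i ni [Xy|Xy]]; exists i; [exists Minus|exists Plus].
move=> x [y [i [e [ni Xy]]] yx]; apply: leq_trans (R_dim yx) _.
by rewrite (cell_dim cX ni Xy).
Qed.

(** One inclusion is [hull_bd]; the other is purity for the top layer. *)
Lemma hull_bd1 n X e : hulls_wf n -> cell n.+1 X ->
  bd1 e n (hull n.+1 X) = hull n (cut n (X n e) X).
Proof.
move=> gn cX; rewrite /bd1 hull_layer //; apply/seteqP; split=> x; last first.
  move=> Xx; split; last exact: hull_bd Xx.
  move: Xx => [y [i [e' [+ +]]] yx]; rewrite leq_eqVlt => /orP[/eqP->|ni].
    by rewrite cut_eq => Xy; exact: hullI (leqnSn n) Xy yx.
  by rewrite cut_lt // => Xy; exact: hullI (leqW (ltnW ni)) Xy yx.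
set M := top n.+1 X; move=> [[y [i [e' [ni Xy]]] yx] nx].
have Mn : M `<=` @cells P n.+1 by move=> z; exact: cell_dim cX (leqnn _).
have fM : finite_set M by have [[/(_ n.+1 Minus (leqnn _))[]]] := cX.
have mM : moves M (X n Minus) (X n Plus).
  by have [_ + _] := cX; apply; exact: ltnSn.
have RM : rel_im (@R P) M x -> hull n (cut n (X n e) X) x.
  move=> Mx; have [c Mc cx] := R_outer fM Mn Mx nx.
  apply: (hullI (e := e) (leqnn n) _ cx); rewrite cut_eq.
  have [h1 h2] := mM; case: (e) Mc => -[Mc nMc].
    by rewrite h1; split => //; right.
  by rewrite h2; split => //; right.
move: ni Xy; rewrite leq_eqVlt => /orP[/eqP->|ni Xy].
  by rewrite (topE _ cX) => My; apply: RM; exists y.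
move: ni Xy; rewrite ltnS leq_eqVlt => /orP[/eqP->|ni Xy]; last first.
  by apply: (hullI (e := e') (ltnW ni) _ yx); rewrite cut_lt.
have [Xy|nXy] := pselect (X n e y).
  by move=> _; apply: (hullI (e := e) (leqnn n) _ yx); rewrite cut_eq.
move=> Xy; apply: RM.
suff [m Mm my] : exists2 m, M m & R m y by exists m => //; exact: R_trans yx.
have [h1 h2] := mM.
(* An element in only one of the two n-boundaries is a face of [M], by the moving equations. *)
have : faces Minus M y \/ faces Plus M y.
  move: nXy Xy; case: (e); case: (e') => nXy //.
  - by rewrite h2 => -[[//|]]; right.
  - by rewrite h1 => -[[//|]]; left.
by move=> [[m Mm my]|[m Mm my]]; exists m => //; exact: face_R my.
Qed.

Lemma hulls_wfP n : hulls_wf n.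
Proof.
elim: n => [|n IH] X cX.
  split => //; split => //; [exact: hull_fgs|exact: rel_imR_closed|].
  by rewrite hull_layer //; have [_ _ /(_ 0 Minus (leqnn 0))] := cX.
have wb e : wf n (bd1 e n (hull n.+1 X)).
  by rewrite hull_bd1 //; have [] := IH _ (cell_bd e cX).
split.
  split => //; [exact: hull_fgs|exact: rel_imR_closed|].
  by rewrite hull_layer //; have [_ _ /(_ n.+1 Minus (leqnn _))] := cX.
(* The layer [X i e] lies in the hull of the [e]-boundary, which [hull_bd] separates from the
   opposite boundary of the top layer. *)
move=> i e y; rewrite ltnS => ni Xy; exists (opp e).
apply: (hull_bd IH cX); apply: (hullI (e := e) ni _ (R_refl y)).
move: ni Xy; rewrite leq_eqVlt => /orP[/eqP->|ni]; first by rewrite cut_eq.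
by rewrite cut_lt.
Qed.

(** * The segment axiom and conclusion *)

Lemma segments : segment_axiom P.
Proof.
move=> u n X e nu cX uX; have [wX _] := hulls_wfP cX.
have [_ bdE _] := wf_atom e (ltnW nu).
have sub : bd e n (dim u) (R u) `<=` hull n X.
  rewrite bdE => x [y uy yx].
  exact: (hullI (e := Minus) (leqnn n) (uX _ uy) yx).
have [h1 h2] := lf_segment hP nu wX erefl.
by rewrite -(hull_layer cX); case: (e) sub; [exact: h1|exact: h2].
Qed.

End LoopFree.

Theorem mainTheorem8 (P : prePasting) (hP : loop_free P) :
  [/\ nonemptiness_axiom (hypergraph_of P),
      acyclicity_axiom (hypergraph_of P),
      relevance_axiom (hypergraph_of P) &
      segment_axiom (hypergraph_of P)] /\
  (torsion_freeness_axiom (hypergraph_of P) ->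
     torsion_free_complex (hypergraph_of P)).
Proof.
have [ne ac re se] := And4 (nonempty hP) (acyclic hP) (relevance hP) (segments hP).
by split.
Qed.
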